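(* Let $R=\partial_r\Gamma/\partial_z\Gamma$. Assume that in the inner core $x+|y|\le\kappa\lambda$, on a bootstrap time interval, $$\partial_ru^r-\partial_zu^z\ge c_0\sigma,\qquad|\partial_zu^r|\le C\sigma,$$ with $c_0,C>0$, and that the off-diagonal shear estimate $$|\partial_ru^z(1-x,y)|\le C\kappa\sigma+\operatorname{Tail}_{\rm shear}[G]+\operatorname{Smooth}_{\rm shear}[G]+O(\lambda)\sigma$$ holds with the right-hand side bounded by $\delta\sigma$ (so $|\partial_ru^z|\le\delta\sigma$), with $\delta\ll1$. Then $$D_t|R|\le-c_0\sigma|R|+\delta\sigma+C\sigma|R|^2.$$ Consequently, if $|R(0)|\le\varepsilon$ and $\delta\ll\varepsilon\ll1$, then $|R(t)|\le2\varepsilon$ throughout the bootstrap interval.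
   Context: $u=u^re_r+u^\theta e_\theta+u^ze_z$ is a smooth axisymmetric Euler solution with swirl in the periodic cylinder $\{0<r<1,\ z\in\mathbb T\}$ with $u^r(1,z,t)=0$; $\Gamma=ru^\theta$ satisfies $D_t\Gamma=0$, $D_t=\partial_t+u^r\partial_r+u^z\partial_z$; $G=\omega^\theta/r$ with $\omega^\theta=\partial_zu^r-\partial_ru^z$; $\sigma(t)=-\partial_zu^z(1,0,t)$. Flattened coordinates $x=1-r$, $y=z$; $\lambda$ is the packet scale and $\kappa$ the inner-core parameter. $R$ is considered where $\partial_z\Gamma\ne0$; it satisfies $D_tR=-\partial_ru^z+(\partial_zu^z-\partial_ru^r)R+(\partial_zu^r)R^2$. $R(t)$ in the last assertion is $R$ along meridional particle trajectories in the inner core; the inequality for $D_t|R|$ is understood in the usual a.e./Dini sense at zeros of $R$. $\operatorname{Tail}_{\rm shear}$ and $\operatorname{Smooth}_{\rm shear}$ are the contributions to the Green-kernel representation of $\partial_ru^z$ from sources outside the packet and from the smooth part of the kernel; only the bound $|\partial_ru^z|\le\delta\sigma$ matters here. The notation $\delta\ll\varepsilon\ll1$ means sufficiently small depending only on $c_0,C$ (with $\delta$ small compared with $\varepsilon$). *)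

(* Defs.v *)
From Stdlib Require Import Reals ZArith.
From Coquelicot Require Import Coquelicot.

Open Scope R_scope.

(* Axisymmetric scalar fields, as functions of (r, z, t).  The torus variable z
   is lifted to R; periodicity is a separate requirement. *)
Definition field := R -> R -> R -> R.

Definition d_r (f : field) : field := fun r z t => Derive (fun s => f s z t) r.
Definition d_z (f : field) : field := fun r z t => Derive (fun s => f r s t) z.
Definition d_t (f : field) : field := fun r z t => Derive (fun s => f r z s) t.

Fixpoint Ck (n : nat) (U : R * R * R -> Prop) (f : field) : Prop :=
  (forall q : R * R * R, U q ->
     continuous (fun q : R * R * R => f (fst (fst q)) (snd (fst q)) (snd q)) q) /\
  match n with
  | O => True
  | S m =>
      (forall r z t, U (r, z, t) ->
         ex_derive (fun s => f s z t) r /\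
         ex_derive (fun s => f r s t) z /\
         ex_derive (fun s => f r z s) t) /\
      Ck m U (d_r f) /\ Ck m U (d_z f) /\ Ck m U (d_t f)
  end.

(* The cylinder with its lateral wall r = 1, over the time interval [0, T]. *)
Definition in_cylinder (T r t : R) : Prop := 0 < r <= 1 /\ 0 <= t <= T.

(* Smoothness up to the wall and up to the end times: f is smooth on some open
   neighbourhood.  The derivatives at r = 1, t = 0 and t = T do not depend on the
   values of f outside the cylinder. *)
Definition smooth_on_cylinder (T : R) (f : field) : Prop :=
  exists U : R * R * R -> Prop,
    open U /\
    (forall r z t, in_cylinder T r t -> U (r, z, t)) /\
    forall n, Ck n U f.

Definition z_periodic (L T : R) (f : field) : Prop :=
  forall r z t, in_cylinder T r t -> f r (z + L) t = f r z t.

Definition D_t (ur uz f : field) : field := fun r z t =>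
  d_t f r z t + ur r z t * d_r f r z t + uz r z t * d_z f r z t.

(* The incompressible Euler equations in cylindrical coordinates for
   u = ur e_r + uth e_theta + uz e_z, all independent of theta, with pressure p,
   in the cylinder of period L, with impermeable wall. *)
Record axisymmetric_euler (L T : R) (ur uth uz p : field) : Prop := {
  euler_smooth_ur : smooth_on_cylinder T ur;
  euler_smooth_uth : smooth_on_cylinder T uth;
  euler_smooth_uz : smooth_on_cylinder T uz;
  euler_smooth_p : smooth_on_cylinder T p;
  euler_periodic_ur : z_periodic L T ur;
  euler_periodic_uth : z_periodic L T uth;
  euler_periodic_uz : z_periodic L T uz;
  euler_periodic_p : z_periodic L T p;
  euler_r : forall r z t, 0 < r < 1 -> 0 <= t <= T ->
    D_t ur uz ur r z t - (uth r z t) ^ 2 / r = - d_r p r z t;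
  euler_th : forall r z t, 0 < r < 1 -> 0 <= t <= T ->
    D_t ur uz uth r z t + ur r z t * uth r z t / r = 0;
  euler_z : forall r z t, 0 < r < 1 -> 0 <= t <= T ->
    D_t ur uz uz r z t = - d_z p r z t;
  euler_div : forall r z t, 0 < r < 1 -> 0 <= t <= T ->
    d_r ur r z t + ur r z t / r + d_z uz r z t = 0;
  euler_wall : forall z t, 0 <= t <= T -> ur 1 z t = 0
}.

Definition Gam (uth : field) : field := fun r z t => r * uth r z t.

Definition vort_G (ur uz : field) : field := fun r z t =>
  (d_z ur r z t - d_r uz r z t) / r.

Definition sigma_wall (uz : field) (t : R) : R := - d_z uz 1 0 t.

(* Meaningful only where d_z (Gam uth) is nonzero. *)
Definition Rslope (uth : field) : field := fun r z t =>
  d_r (Gam uth) r z t / d_z (Gam uth) r z t.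

Definition abs_field (f : field) : field := fun r z t => Rabs (f r z t).

(* x + |y| <= kappa * lam, in the coordinates x = 1 - r, y = z, where |y| is the
   distance from y to 0 in the torus R / L Z. *)
Definition inner_core (L kappa lam r z : R) : Prop :=
  0 < r <= 1 /\ exists k : Z, (1 - r) + Rabs (z - IZR k * L) <= kappa * lam.

(* (X, Z) solves X' = ur, Z' = uz on [a, b].  Since ur, uz are continuous,
   continuity on [a, b] together with the equations on (a, b) gives the one-sided
   equations at a and b. *)
Definition trajectory (ur uz : field) (a b : R) (X Z : R -> R) : Prop :=
  (forall t, a <= t <= b -> 0 < X t <= 1) /\
  continuous_on (fun t => a <= t <= b) X /\
  continuous_on (fun t => a <= t <= b) Z /\
  forall t, a < t < b ->
    is_derive X t (ur (X t) (Z t) t) /\ is_derive Z t (uz (X t) (Z t) t).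

(* limsup_{h -> 0+} (f (t + h) - f t) / h <= M *)
Definition upper_right_dini_le (f : R -> R) (t M : R) : Prop :=
  forall eta, 0 < eta ->
    at_right 0 (fun h => (f (t + h) - f t) / h <= M + eta).

(* Main.v *)
Require Import Defs.
From Stdlib Require Import Reals ZArith Lra Psatz.
From Coquelicot Require Import Coquelicot.
Open Scope R_scope.

(** Since [Gam] is carried by the flow, differentiating [D_t Gam = 0] in [r] and
    [z] shows that its gradient solves a linear system along trajectories
    ([D_t_grad_Gam]), and the ratio [Rslope] of the two components therefore
    solves the Riccati equation of [Rslope_riccati].  Its linear coefficient
    [d_z uz - d_r ur] is at most [- c0 * sigma], its quadratic coefficient is at
    most [C * sigma] and its forcing [- d_r uz] at most [delta * sigma] in absolute
    value; multiplying by the sign of [Rslope] gives the differential inequality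
    for the absolute value.

    Along a trajectory only the right derivative is available at the initial
    time, and the absolute value has a corner at the zeros of [Rslope].  Both are
    handled by one estimate ([upper_right_dini_abs]): if a right derivative of [g]
    is [c + m * g t], then [g (t + h)] is [(1 + h * m) * g t + h * c] up to [o(h)],
    and [1 + h * m >= 0] for small [h], so that the triangle inequality bounds the
    Dini derivative of [Rabs g] by [Rabs c + m * Rabs (g t)] without any case
    distinction on the sign of [g t].

    For the last assertion, let [eps <= c0 / (4 * C)] and
    [delta <= c0 / 2 * eps].  While [eps <= Rabs R <= 2 * eps], the quadratic term
    is at most half of the damping and the forcing at most the other half, so the
    right-hand side is nonpositive.  Hence [Rabs R] cannot cross a line that
    starts at [eps] and rises to less than [2 * eps] with positive slope
    ([dini_barrier]); the slope gives the strictness that a bare [<= 0] lacks, as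
    [sigma] may vanish. *)

(** * Smoothness near a point *)

(** Smoothness up to the wall and the end times, localized: every point of the
    cylinder, wall included, is interior to a set where the field is smooth, so two-sided
    derivatives are meaningful there. *)
Definition smooth_near (f : field) (r z t : R) : Prop :=
  exists U : R * R * R -> Prop, open U /\ U (r, z, t) /\ forall n, Ck n U f.

Lemma open_box (U : R * R * R -> Prop) (r z t : R) :
  open U -> U (r, z, t) ->
  exists d : posreal, forall r' z' t',
    Rabs (r' - r) < d -> Rabs (z' - z) < d -> Rabs (t' - t) < d -> U (r', z', t').
Proof.
  intros HU Hq.
  destruct (HU _ Hq) as [d Hd].
  exists d; intros r' z' t' H1 H2 H3.
  apply Hd; repeat split; assumption.
Qed.

Lemma Rabs_minus_diag (x : R) (d : posreal) : Rabs (x - x) < d.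
Proof. rewrite Rminus_diag, Rabs_R0; apply cond_pos. Qed.

Lemma open_slices (U : R * R * R -> Prop) (r z t : R) :
  open U -> U (r, z, t) ->
  locally r (fun s => U (s, z, t)) /\
  locally z (fun s => U (r, s, t)) /\
  locally t (fun s => U (r, z, s)).
Proof.
  intros HU Hq; destruct (open_box U r z t HU Hq) as [d Hd].
  repeat split; exists d; intros s Hs; apply Hd; solve [exact Hs | apply Rabs_minus_diag].
Qed.

(** The partial derivatives of a sum or a product are known only on the open set
    of smoothness, so [Ck] has to be transported along equality on that set. *)
Lemma Ck_ext (n : nat) (U : R * R * R -> Prop) (f g : field) :
  open U -> (forall r z t, U (r, z, t) -> f r z t = g r z t) -> Ck n U f -> Ck n U g.
Proof.
  intros HU; revert f g; induction n as [|n IH]; intros f g Hfg [Hc H]; split; trivial.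
  1, 2: intros [[r z] t] Hq; apply continuous_ext_loc with (2 := Hc _ Hq);
    apply filter_imp with (2 := HU _ Hq); intros [[r' z'] t'] Hq'; apply Hfg; exact Hq'.
  destruct H as (Hd & Hr & Hz & Ht).
  split; [|repeat split].
  - intros r z t Hq.
    destruct (open_slices U r z t HU Hq) as (Sr & Sz & St).
    destruct (Hd r z t Hq) as (Dr & Dz & Dt).
    repeat split; [ apply ex_derive_ext_loc with (2 := Dr); revert Sr
                  | apply ex_derive_ext_loc with (2 := Dz); revert Sz
                  | apply ex_derive_ext_loc with (2 := Dt); revert St ];
      apply filter_imp; intros s; apply Hfg.
  - apply IH with (2 := Hr); intros r z t Hq; apply Derive_ext_loc.
    destruct (open_slices U r z t HU Hq) as (Sr & _ & _); revert Sr;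
      apply filter_imp; intros s; apply Hfg.
  - apply IH with (2 := Hz); intros r z t Hq; apply Derive_ext_loc.
    destruct (open_slices U r z t HU Hq) as (_ & Sz & _); revert Sz;
      apply filter_imp; intros s; apply Hfg.
  - apply IH with (2 := Ht); intros r z t Hq; apply Derive_ext_loc.
    destruct (open_slices U r z t HU Hq) as (_ & _ & St); revert St;
      apply filter_imp; intros s; apply Hfg.
Qed.

Lemma Ck_plus (n : nat) (U : R * R * R -> Prop) (f g : field) :
  open U -> Ck n U f -> Ck n U g -> Ck n U (fun r z t => f r z t + g r z t).
Proof.
  intros HU; revert f g; induction n as [|n IH]; intros f g [Cf Hf] [Cg Hg]; split; trivial.
  1, 2: intros q Hq; exact (continuous_plus _ _ q (Cf q Hq) (Cg q Hq)).
  destruct Hf as (Df & Fr & Fz & Ft), Hg as (Dg & Gr & Gz & Gt).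
  split; [|repeat split].
  - intros r z t Hq; destruct (Df r z t Hq) as (? & ? & ?), (Dg r z t Hq) as (? & ? & ?).
    repeat split; apply (ex_derive_plus (V := R_NormedModule)); assumption.
  - apply Ck_ext with (3 := IH _ _ Fr Gr); trivial; intros r z t Hq.
    destruct (Df r z t Hq) as (? & ? & ?), (Dg r z t Hq) as (? & ? & ?).
    symmetry; apply Derive_plus; assumption.
  - apply Ck_ext with (3 := IH _ _ Fz Gz); trivial; intros r z t Hq.
    destruct (Df r z t Hq) as (? & ? & ?), (Dg r z t Hq) as (? & ? & ?).
    symmetry; apply Derive_plus; assumption.
  - apply Ck_ext with (3 := IH _ _ Ft Gt); trivial; intros r z t Hq.
    destruct (Df r z t Hq) as (? & ? & ?), (Dg r z t Hq) as (? & ? & ?).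
    symmetry; apply Derive_plus; assumption.
Qed.

(** The induction needs all orders of [f] at once, because
    [d_r (r * f) = f + r * d_r f] involves [f] again. *)
Lemma Ck_Gam (U : R * R * R -> Prop) (f : field) :
  open U -> (forall n, Ck n U f) -> forall n, Ck n U (Gam f).
Proof.
  intros HU Hf n; revert f Hf; induction n as [|n IH]; intros f Hf; split; trivial.
  1, 2: intros q Hq; destruct (Hf O) as [Cf _];
    refine (continuous_mult _ _ q _ (Cf q Hq));
    apply (continuous_comp fst fst); apply continuous_fst.
  assert (D := proj1 (proj2 (Hf 1%nat))).
  split; [|repeat split].
  - intros r z t Hq; destruct (D r z t Hq) as (? & ? & ?); unfold Gam.
    split; [|split].
    + apply (ex_derive_mult (fun s => s)); [apply ex_derive_id | assumption].
    + apply ex_derive_scal; assumption.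
    + apply ex_derive_scal; assumption.
  - apply Ck_ext with (3 := Ck_plus n U f (Gam (d_r f)) HU (Hf n)
        (IH (d_r f) (fun m => proj1 (proj2 (proj2 (Hf (S m))))))); trivial.
    intros r z t Hq; destruct (D r z t Hq) as (Dr & _ & _).
    unfold d_r at 2, Gam; rewrite Derive_mult; [|apply ex_derive_id|exact Dr].
    rewrite Derive_id; unfold d_r; ring.
  - apply Ck_ext with (3 := IH (d_z f) (fun m => proj1 (proj2 (proj2 (proj2 (Hf (S m)))))));
      trivial.
    intros r z t Hq; unfold Gam, d_z; rewrite Derive_scal; reflexivity.
  - apply Ck_ext with (3 := IH (d_t f) (fun m => proj2 (proj2 (proj2 (proj2 (Hf (S m)))))));
      trivial.
    intros r z t Hq; unfold Gam, d_t; rewrite Derive_scal; reflexivity.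
Qed.

Lemma smooth_near_of_cylinder (T : R) (f : field) (r z t : R) :
  smooth_on_cylinder T f -> in_cylinder T r t -> smooth_near f r z t.
Proof. intros (U & HU & Hin & Hf) Hq; exists U; auto. Qed.

Lemma smooth_near_Gam (f : field) (r z t : R) :
  smooth_near f r z t -> smooth_near (Gam f) r z t.
Proof. intros (U & HU & Hq & Hf); exists U; repeat split; trivial; apply Ck_Gam; trivial. Qed.

Lemma smooth_near_partials (f : field) (r z t : R) :
  smooth_near f r z t ->
  smooth_near (d_r f) r z t /\ smooth_near (d_z f) r z t /\ smooth_near (d_t f) r z t.
Proof.
  intros (U & HU & Hq & Hf); repeat split; exists U; repeat split; trivial; intros n;
    apply (Hf (S n)).
Qed.

Lemma smooth_near_box (f : field) (r z t : R) :
  smooth_near f r z t ->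
  exists d : posreal, forall r' z' t',
    Rabs (r' - r) < d -> Rabs (z' - z) < d -> Rabs (t' - t) < d -> smooth_near f r' z' t'.
Proof.
  intros (U & HU & Hq & Hf); destruct (open_box U r z t HU Hq) as [d Hd].
  exists d; intros r' z' t' H1 H2 H3; exists U; auto.
Qed.

Lemma smooth_near_ex_derive (f : field) (r z t : R) :
  smooth_near f r z t ->
  ex_derive (fun s => f s z t) r /\ ex_derive (fun s => f r s t) z /\
  ex_derive (fun s => f r z s) t.
Proof. intros (U & _ & Hq & Hf); apply (Hf 1%nat); exact Hq. Qed.

Lemma smooth_near_is_derive (f : field) (r z t : R) :
  smooth_near f r z t ->
  is_derive (fun s => f s z t) r (d_r f r z t) /\
  is_derive (fun s => f r s t) z (d_z f r z t) /\
  is_derive (fun s => f r z s) t (d_t f r z t).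
Proof.
  intros H; destruct (smooth_near_ex_derive f r z t H) as (? & ? & ?).
  repeat split; apply Derive_correct; assumption.
Qed.

Lemma smooth_near_continuous (f : field) (r z t : R) :
  smooth_near f r z t ->
  continuous (fun q : R * R * R => f (fst (fst q)) (snd (fst q)) (snd q)) (r, z, t).
Proof. intros (U & _ & Hq & Hf); apply (Hf O); exact Hq. Qed.

Lemma smooth_near_eps (f : field) (r z t : R) (eps : posreal) :
  smooth_near f r z t ->
  exists d : posreal, forall r' z' t',
    Rabs (r' - r) < d -> Rabs (z' - z) < d -> Rabs (t' - t) < d ->
    Rabs (f r' z' t' - f r z t) < eps.
Proof.
  intros H; apply smooth_near_continuous in H.
  destruct (proj1 (filterlim_locally _ _) H eps) as [d Hd].
  exists d; intros r' z' t' H1 H2 H3.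
  apply (Hd (r', z', t')); repeat split; assumption.
Qed.

(** Schwarz's theorem in each of the three coordinate planes. *)
Lemma mixed_partials (f : field) (r z t : R) :
  smooth_near f r z t ->
  d_r (d_z f) r z t = d_z (d_r f) r z t /\
  d_r (d_t f) r z t = d_t (d_r f) r z t /\
  d_z (d_t f) r z t = d_t (d_z f) r z t.
Proof.
  intros H.
  destruct (smooth_near_box f r z t H) as [d Hd].
  destruct (smooth_near_partials f r z t H) as (Hr & Hz & Ht).
  destruct (smooth_near_partials _ r z t Hr) as (_ & Hrz & Hrt).
  destruct (smooth_near_partials _ r z t Hz) as (Hzr & _ & Hzt).
  destruct (smooth_near_partials _ r z t Ht) as (Htr & Htz & _).
  assert (E : forall r' z' t', smooth_near f r' z' t' ->
    (ex_derive (fun s => f s z' t') r' /\ ex_derive (fun s => f r' s t') z' /\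
     ex_derive (fun s => f r' z' s) t') /\
    (ex_derive (fun s => d_r f r' s t') z' /\ ex_derive (fun s => d_r f r' z' s) t') /\
    (ex_derive (fun s => d_z f s z' t') r' /\ ex_derive (fun s => d_z f r' z' s) t') /\
    (ex_derive (fun s => d_t f s z' t') r' /\ ex_derive (fun s => d_t f r' s t') z')).
  { intros r' z' t' H'.
    destruct (smooth_near_partials f r' z' t' H') as (K1 & K2 & K3).
    apply smooth_near_ex_derive in H', K1, K2, K3; tauto. }
  repeat split.
  - apply (Schwarz (fun u v => f u v t)).
    + exists d; intros u v Hu Hv.
      destruct (E u v t (Hd u v t Hu Hv (Rabs_minus_diag t d))) as (? & ? & ? & ?).
      unfold d_r, d_z, d_t in *; tauto.
    + intros eps; destruct (smooth_near_eps _ r z t eps Hzr) as [k Hk].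
      exists k; intros u v Hu Hv; apply (Hk u v t Hu Hv (Rabs_minus_diag t k)).
    + intros eps; destruct (smooth_near_eps _ r z t eps Hrz) as [k Hk].
      exists k; intros u v Hu Hv; apply (Hk u v t Hu Hv (Rabs_minus_diag t k)).
  - apply (Schwarz (fun u v => f u z v)).
    + exists d; intros u v Hu Hv.
      destruct (E u z v (Hd u z v Hu (Rabs_minus_diag z d) Hv)) as (? & ? & ? & ?).
      unfold d_r, d_z, d_t in *; tauto.
    + intros eps; destruct (smooth_near_eps _ r z t eps Htr) as [k Hk].
      exists k; intros u v Hu Hv; apply (Hk u z v Hu (Rabs_minus_diag z k) Hv).
    + intros eps; destruct (smooth_near_eps _ r z t eps Hrt) as [k Hk].
      exists k; intros u v Hu Hv; apply (Hk u z v Hu (Rabs_minus_diag z k) Hv).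
  - apply (Schwarz (fun u v => f r u v)).
    + exists d; intros u v Hu Hv.
      destruct (E r u v (Hd r u v (Rabs_minus_diag r d) Hu Hv)) as (? & ? & ? & ?).
      unfold d_r, d_z, d_t in *; tauto.
    + intros eps; destruct (smooth_near_eps _ r z t eps Htz) as [k Hk].
      exists k; intros u v Hu Hv; apply (Hk r u v (Rabs_minus_diag r k) Hu Hv).
    + intros eps; destruct (smooth_near_eps _ r z t eps Hzt) as [k Hk].
      exists k; intros u v Hu Hv; apply (Hk r u v (Rabs_minus_diag r k) Hu Hv).
Qed.

(** * Transport of the gradient of the circulation *)

(** The Euler equations are given for [r < 1]; identities between continuous
    fields pass to the wall. *)
Lemma zero_up_to_wall (h : R -> R) :
  continuous h 1 -> (forall r, 0 < r < 1 -> h r = 0) -> h 1 = 0.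
Proof.
  intros Hc H0; destruct (Req_dec (h 1) 0) as [E|E]; trivial; exfalso.
  destruct (proj1 (filterlim_locally _ _) Hc (mkposreal _ (Rabs_pos_lt _ E))) as [d Hd].
  set (s := 1 - Rmin d 1 / 2).
  assert (Hm : 0 < Rmin d 1 <= 1 /\ Rmin d 1 <= d).
  { split; [split|]; [apply Rmin_glb_lt; [apply cond_pos | lra] | apply Rmin_r | apply Rmin_l]. }
  assert (Hs : Rabs (h s - h 1) < Rabs (h 1)).
  { apply Hd; change (Rabs (s - 1) < d); unfold s; rewrite Rabs_left; lra. }
  rewrite H0, Rminus_0_l, Rabs_Ropp in Hs by (unfold s; lra); lra.
Qed.

Lemma is_derive_advect (a u b w c : R -> R) (x a' u' b' w' c' : R) :
  is_derive a x a' -> is_derive u x u' -> is_derive b x b' ->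
  is_derive w x w' -> is_derive c x c' ->
  is_derive (fun s => a s + u s * b s + w s * c s) x
    (a' + (u' * b x + u x * b') + (w' * c x + w x * c')).
Proof.
  intros Ha Hu Hb Hw Hc; auto_derive.
  - repeat split; eexists; eassumption.
  - apply is_derive_unique in Ha, Hu, Hb, Hw, Hc; 
    change (fun x => a x) with a; change (fun x => u x) with u; change (fun x => b x) with b;
    change (fun x => w x) with w; change (fun x => c x) with c.
    rewrite Ha, Hu, Hb, Hw, Hc; ring.
Qed.

Lemma is_derive_locally_zero (h : R -> R) (x l : R) :
  is_derive h x l -> locally x (fun s => h s = 0) -> l = 0.
Proof.
  intros Hl Hz; rewrite <- (is_derive_unique _ _ _ Hl), (Derive_ext_loc _ (fun _ => 0)); trivial.
  apply Derive_const.
Qed.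

Lemma smooth_near_continuous_r (f : field) (r z t : R) :
  smooth_near f r z t -> continuous (fun s => f s z t) r.
Proof. intros H; exact (ex_derive_continuous _ _ (proj1 (smooth_near_ex_derive f r z t H))). Qed.

(** Conservation of angular momentum: [D_t Gam] is [r] times the left-hand side
    of the azimuthal Euler equation. *)
Lemma D_t_Gam (L T : R) (ur uth uz p : field) (r z t : R) :
  axisymmetric_euler L T ur uth uz p -> 0 < r < 1 -> 0 <= t <= T -> D_t ur uz (Gam uth) r z t = 0.
Proof.
  intros HE Hr Ht.
  assert (S : smooth_near uth r z t).
  { apply (smooth_near_of_cylinder T); [apply HE | split; lra]. }
  destruct (smooth_near_ex_derive _ _ _ _ S) as (Dr & _ & _).
  assert (Eth := euler_th _ _ _ _ _ _ HE r z t Hr Ht).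
  unfold D_t in *.
  replace (d_r (Gam uth) r z t) with (uth r z t + r * d_r uth r z t).
  2: { unfold Gam, d_r at 2; rewrite Derive_mult; [|apply ex_derive_id|exact Dr].
       rewrite Derive_id; unfold d_r; ring. }
  replace (d_z (Gam uth) r z t) with (r * d_z uth r z t)
    by (unfold Gam, d_z; rewrite Derive_scal; reflexivity).
  replace (d_t (Gam uth) r z t) with (r * d_t uth r z t)
    by (unfold Gam, d_t; rewrite Derive_scal; reflexivity).
  transitivity (r * 0); [rewrite <- Eth; field; lra | ring].
Qed.

(** The commutator of [D_t] with a partial derivative is the derivative of the
    velocity contracted with the gradient; at the wall this follows by continuity. *)
Lemma D_t_grad_Gam (L T : R) (ur uth uz p : field) (r z t : R) :
  axisymmetric_euler L T ur uth uz p -> in_cylinder T r t ->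
  D_t ur uz (d_r (Gam uth)) r z t =
    - (d_r ur r z t * d_r (Gam uth) r z t + d_r uz r z t * d_z (Gam uth) r z t) /\
  D_t ur uz (d_z (Gam uth)) r z t =
    - (d_z ur r z t * d_r (Gam uth) r z t + d_z uz r z t * d_z (Gam uth) r z t).
Proof.
  set (g := Gam uth); intros HE Hq.
  assert (S : forall s, in_cylinder T s t ->
    smooth_near ur s z t /\ smooth_near uz s z t /\ smooth_near g s z t).
  { intros s Hs; repeat split; [| |apply smooth_near_Gam];
      apply (smooth_near_of_cylinder T); trivial; apply HE. }
  set (hr := fun s => D_t ur uz (d_r g) s z t +
    (d_r ur s z t * d_r g s z t + d_r uz s z t * d_z g s z t)).
  set (hz := fun s => D_t ur uz (d_z g) s z t +
    (d_z ur s z t * d_r g s z t + d_z uz s z t * d_z g s z t)).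
  assert (Int : forall s, 0 < s < 1 -> hr s = 0 /\ hz s = 0).
  { intros s Hs.
    assert (Hst : in_cylinder T s t) by (destruct Hq; split; lra).
    destruct (S s Hst) as (Sr & Sz & Sg).
    destruct (smooth_near_partials g s z t Sg) as (Gr & Gz & Gt).
    destruct (mixed_partials g s z t Sg) as (Mrz & Mrt & Mzt).
    assert (Tr : forall r', 0 < r' < 1 -> forall z', D_t ur uz g r' z' t = 0)
      by (intros r' Hr' z'; apply (D_t_Gam L T ur uth uz p); trivial; apply Hq).
    split; [unfold hr | unfold hz]; unfold D_t.
    - assert (K := is_derive_locally_zero (fun s => D_t ur uz g s z t) s _
        (is_derive_advect (fun s => d_t g s z t) (fun s => ur s z t) (fun s => d_r g s z t)
           (fun s => uz s z t) (fun s => d_z g s z t) s _ _ _ _ _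
           (proj1 (smooth_near_is_derive _ _ _ _ Gt))
           (proj1 (smooth_near_is_derive _ _ _ _ Sr))
           (proj1 (smooth_near_is_derive _ _ _ _ Gr))
           (proj1 (smooth_near_is_derive _ _ _ _ Sz))
           (proj1 (smooth_near_is_derive _ _ _ _ Gz)))).
      rewrite Mrt, Mrz in K; rewrite <- K; [ring|].
      apply filter_imp with (fun s' => 0 < s' < 1); [intros s' Hs'; apply Tr; exact Hs'|].
      apply locally_interval with 0 1; simpl; tauto.
    - assert (K := is_derive_locally_zero (fun y => D_t ur uz g s y t) z _
        (is_derive_advect (fun y => d_t g s y t) (fun y => ur s y t) (fun y => d_r g s y t)
           (fun y => uz s y t) (fun y => d_z g s y t) z _ _ _ _ _
           (proj1 (proj2 (smooth_near_is_derive _ _ _ _ Gt)))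
           (proj1 (proj2 (smooth_near_is_derive _ _ _ _ Sr)))
           (proj1 (proj2 (smooth_near_is_derive _ _ _ _ Gr)))
           (proj1 (proj2 (smooth_near_is_derive _ _ _ _ Sz)))
           (proj1 (proj2 (smooth_near_is_derive _ _ _ _ Gz))))).
      rewrite Mzt, <- Mrz in K; rewrite <- K; [ring|].
      apply filter_forall; intros y; apply Tr; exact Hs. }
  enough (Z : hr r = 0 /\ hz r = 0) by (unfold hr, hz in Z; lra).
  destruct (Rlt_dec r 1) as [Hr|Hr]; [apply Int; destruct Hq; lra|].
  assert (E : r = 1) by (destruct Hq; lra); subst r.
  destruct (S 1 Hq) as (Sr & Sz & Sg).
  destruct (smooth_near_partials _ _ _ _ Sr) as (Srr & Srz & _).
  destruct (smooth_near_partials _ _ _ _ Sz) as (Szr & Szz & _).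
  destruct (smooth_near_partials _ _ _ _ Sg) as (Gr & Gz & _).
  destruct (smooth_near_partials _ _ _ _ Gr) as (Grr & Grz & Grt).
  destruct (smooth_near_partials _ _ _ _ Gz) as (Gzr & Gzz & Gzt).
  split; apply zero_up_to_wall; try apply Int; unfold hr, hz, D_t;
    repeat first [ apply smooth_near_continuous_r; assumption
                 | apply (continuous_plus (V := R_NormedModule))
                 | apply (continuous_mult (K := R_AbsRing)) ].
Qed.

(** * The Riccati equation *)

Lemma D_t_quotient (ur uz a b : field) (r z t : R) :
  smooth_near a r z t -> smooth_near b r z t -> b r z t <> 0 ->
  D_t ur uz (fun r z t => a r z t / b r z t) r z t =
    (D_t ur uz a r z t * b r z t - a r z t * D_t ur uz b r z t) / (b r z t) ^ 2.
Proof.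
  intros Ha Hb H0.
  destruct (smooth_near_ex_derive _ _ _ _ Ha) as (Ar & Az & At).
  destruct (smooth_near_ex_derive _ _ _ _ Hb) as (Br & Bz & Bt).
  unfold D_t, d_t at 1, d_r at 1, d_z at 1.
  rewrite (Derive_div (fun s => a r z s) (fun s => b r z s)) by assumption.
  rewrite (Derive_div (fun s => a s z t) (fun s => b s z t)) by assumption.
  rewrite (Derive_div (fun s => a r s t) (fun s => b r s t)) by assumption.
  unfold d_r, d_z, d_t; field; exact H0.
Qed.

Lemma Rslope_riccati (L T : R) (ur uth uz p : field) (r z t : R) :
  axisymmetric_euler L T ur uth uz p -> in_cylinder T r t -> d_z (Gam uth) r z t <> 0 ->
  D_t ur uz (Rslope uth) r z t =
    - d_r uz r z t + (d_z uz r z t - d_r ur r z t) * Rslope uth r z t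
    + d_z ur r z t * (Rslope uth r z t) ^ 2.
Proof.
  intros HE Hq H0.
  assert (Sg : smooth_near (Gam uth) r z t)
    by (apply smooth_near_Gam, (smooth_near_of_cylinder T); trivial; apply HE).
  destruct (smooth_near_partials _ _ _ _ Sg) as (Gr & Gz & _).
  destruct (D_t_grad_Gam L T ur uth uz p r z t HE Hq) as [Er Ez].
  unfold Rslope at 1; rewrite D_t_quotient by assumption.
  rewrite Er, Ez; unfold Rslope; field; exact H0.
Qed.

Lemma Derive_Rabs (f : R -> R) (x : R) :
  ex_derive f x -> f x <> 0 -> Derive (fun s => Rabs (f s)) x = sign (f x) * Derive f x.
Proof.
  intros Hf H0; apply is_derive_unique.
  exact (is_derive_Rabs f x _ (Derive_correct _ _ Hf) H0).
Qed.

Lemma D_t_abs_Rslope (ur uth uz : field) (r z t : R) :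
  smooth_near uth r z t -> d_z (Gam uth) r z t <> 0 -> Rslope uth r z t <> 0 ->
  D_t ur uz (abs_field (Rslope uth)) r z t =
    sign (Rslope uth r z t) * D_t ur uz (Rslope uth) r z t.
Proof.
  intros Hs Hz H0.
  destruct (smooth_near_partials _ _ _ _ (smooth_near_Gam _ _ _ _ Hs)) as (Gr & Gz & _).
  destruct (smooth_near_ex_derive _ _ _ _ Gr) as (Ar & Az & At).
  destruct (smooth_near_ex_derive _ _ _ _ Gz) as (Br & Bz & Bt).
  unfold D_t, abs_field, d_t at 1, d_r at 1, d_z at 1.
  rewrite (Derive_Rabs (fun s => Rslope uth r z s) t),
    (Derive_Rabs (fun s => Rslope uth s z t) r),
    (Derive_Rabs (fun s => Rslope uth r s t) z);
    trivial; try (apply ex_derive_div; assumption).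
  unfold d_t, d_r, d_z; ring.
Qed.

(** * Differentiation along trajectories *)

Lemma is_derive_estimate (f : R -> R) (x l : R) :
  is_derive f x l <->
  forall eps : posreal, locally x (fun y => Rabs (f y - f x - l * (y - x)) <= eps * Rabs (y - x)).
Proof.
  split.
  - intros [_ H] eps; specialize (H x (fun P HP => HP) eps); revert H.
    apply filter_imp; intros y Hy.
    replace (l * (y - x)) with ((y - x) * l) by ring; exact Hy.
  - intros H; split; [apply is_linear_scal_l|].
    intros y Hy eps; rewrite <- (is_filter_lim_locally_unique (V := R_NormedModule) _ _ Hy).
    generalize (H eps); apply filter_imp; intros s Hs.
    replace (l * (s - x)) with ((s - x) * l) in Hs by ring; exact Hs.
Qed.

(** The mean value inequality for [h - l * id]. *)
Lemma slope_variation (h dh : R -> R) (a b l eps : R) :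
  (forall u, Rabs (u - a) <= Rabs (b - a) -> is_derive h u (dh u) /\ Rabs (dh u - l) <= eps) ->
  Rabs (h b - h a - l * (b - a)) <= eps * Rabs (b - a).
Proof.
  intros H.
  replace (h b - h a - l * (b - a)) with ((h b - l * b) - (h a - l * a)) by ring.
  apply (bounded_variation (fun u => h u - l * u) (fun u => dh u - l)).
  intros u Hu; destruct (H u Hu) as [Hd He]; split; trivial.
  apply (is_derive_minus (V := R_NormedModule)); trivial.
  evar_last; [apply is_derive_scal, is_derive_id | apply Rmult_1_r].
Qed.

(** Joint differentiability from continuous partial derivatives: the increment is
    split along a path that changes one coordinate at a time, and each leg is
    estimated by [slope_variation]. *)
Lemma smooth_near_frechet (f : field) (r z t : R) (eps : posreal) :
  smooth_near f r z t ->
  exists d : posreal, forall r' z' t',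
    Rabs (r' - r) < d -> Rabs (z' - z) < d -> Rabs (t' - t) < d ->
    Rabs (f r' z' t' - f r z t
          - (d_r f r z t * (r' - r) + d_z f r z t * (z' - z) + d_t f r z t * (t' - t)))
      <= eps * (Rabs (r' - r) + Rabs (z' - z) + Rabs (t' - t)).
Proof.
  intros H.
  destruct (smooth_near_partials _ _ _ _ H) as (Hr & Hz & Ht).
  destruct (smooth_near_box _ _ _ _ H) as [d0 H0].
  destruct (smooth_near_eps _ _ _ _ eps Hr) as [d1 H1].
  destruct (smooth_near_eps _ _ _ _ eps Hz) as [d2 H2].
  destruct (smooth_near_eps _ _ _ _ eps Ht) as [d3 H3].
  assert (Hd : 0 < Rmin (Rmin d0 d1) (Rmin d2 d3))
    by (repeat apply Rmin_glb_lt; apply cond_pos).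
  exists (mkposreal _ Hd); simpl; intros r' z' t' Br Bz Bt.
  assert (M : forall u, u < Rmin (Rmin d0 d1) (Rmin d2 d3) -> u < d0 /\ u < d1 /\ u < d2 /\ u < d3).
  { intros u Hu.
    generalize (Rmin_l (Rmin d0 d1) (Rmin d2 d3)) (Rmin_r (Rmin d0 d1) (Rmin d2 d3))
      (Rmin_l d0 d1) (Rmin_r d0 d1) (Rmin_l d2 d3) (Rmin_r d2 d3); lra. }
  apply M in Br, Bz, Bt.
  assert (Vr : Rabs (f r' z' t' - f r z' t' - d_r f r z t * (r' - r)) <= eps * Rabs (r' - r)).
  { apply (slope_variation (fun u => f u z' t') (fun u => d_r f u z' t')); intros u Hu.
    split; [apply smooth_near_is_derive, H0 | apply Rlt_le, H1]; lra. }
  assert (Vz : Rabs (f r z' t' - f r z t' - d_z f r z t * (z' - z)) <= eps * Rabs (z' - z)).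
  { apply (slope_variation (fun u => f r u t') (fun u => d_z f r u t')); intros u Hu.
    split; [apply smooth_near_is_derive, H0 | apply Rlt_le, H2];
      first [lra | apply Rabs_minus_diag]. }
  assert (Vt : Rabs (f r z t' - f r z t - d_t f r z t * (t' - t)) <= eps * Rabs (t' - t)).
  { apply (slope_variation (fun u => f r z u) (fun u => d_t f r z u)); intros u Hu.
    split; [apply smooth_near_is_derive, H0 | apply Rlt_le, H3];
      first [lra | apply Rabs_minus_diag]. }
  revert Vr Vz Vt; unfold Rabs; repeat destruct Rcase_abs; lra.
Qed.

Lemma is_derive_along_path (f : field) (X Z : R -> R) (t x' z' : R) :
  smooth_near f (X t) (Z t) t -> is_derive X t x' -> is_derive Z t z' ->
  is_derive (fun s => f (X s) (Z s) s) t
    (d_t f (X t) (Z t) t + x' * d_r f (X t) (Z t) t + z' * d_z f (X t) (Z t) t).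
Proof.
  intros Hf HX HZ; apply is_derive_estimate; intros eps.
  set (fr := d_r f (X t) (Z t) t); set (fz := d_z f (X t) (Z t) t); set (ft := d_t f (X t) (Z t) t).
  assert (Px := Rabs_pos x'); assert (Pz := Rabs_pos z').
  assert (Pr := Rabs_pos fr); assert (Pf := Rabs_pos fz).
  (* Budget: the Frechet remainder is spent on increments of size at most
     (|x'| + |z'| + 3) |s - t|, the remainders of the path are multiplied by |fr|, |fz|. *)
  assert (He1 : 0 < eps / (2 * (Rabs x' + Rabs z' + 3)))
    by (apply Rdiv_lt_0_compat; [apply cond_pos | lra]).
  assert (He2 : 0 < Rmin 1 (eps / (2 * (Rabs fr + Rabs fz + 1)))).
  { apply Rmin_glb_lt; [lra | apply Rdiv_lt_0_compat; [apply cond_pos | lra]]. }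
  set (e1 := eps / _) in He1; set (e2 := Rmin _ _) in He2.
  assert (E1 : e1 * (Rabs x' + Rabs z' + 3) = eps / 2) by (unfold e1; field; lra).
  assert (E2 : e2 * (Rabs fr + Rabs fz + 1) <= eps / 2).
  { replace (eps / 2) with (eps / (2 * (Rabs fr + Rabs fz + 1)) * (Rabs fr + Rabs fz + 1))
      by (field; lra).
    apply Rmult_le_compat_r; [lra | apply Rmin_r]. }
  assert (E3 : e2 <= 1) by apply Rmin_l.
  destruct (smooth_near_frechet f _ _ _ (mkposreal _ He1) Hf) as [d Hd].
  assert (CX := proj1 (filterlim_locally _ _)
    (ex_derive_continuous X t (ex_intro _ _ HX)) d).
  assert (CZ := proj1 (filterlim_locally _ _)
    (ex_derive_continuous Z t (ex_intro _ _ HZ)) d).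
  assert (EX := proj1 (is_derive_estimate _ _ _) HX (mkposreal _ He2)).
  assert (EZ := proj1 (is_derive_estimate _ _ _) HZ (mkposreal _ He2)).
  assert (CT : locally t (fun s => Rabs (s - t) < d)) by (exists d; intros s Hs; exact Hs).
  generalize (filter_and _ _ CT (filter_and _ _ (filter_and _ _ CX CZ) (filter_and _ _ EX EZ))).
  apply filter_imp; intros s (Bs & (BX & BZ) & (FX & FZ)); simpl in FX, FZ.
  specialize (Hd (X s) (Z s) s BX BZ Bs); fold fr fz ft in Hd; simpl in Hd.
  set (D := Rabs (s - t)) in *; assert (PD : 0 <= D) by apply Rabs_pos.
  assert (LX : Rabs (X s - X t) <= (1 + Rabs x') * D).
  { replace (X s - X t) with ((X s - X t - x' * (s - t)) + x' * (s - t)) by ring.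
    eapply Rle_trans; [apply Rabs_triang|]; rewrite Rabs_mult; fold D; nra. }
  assert (LZ : Rabs (Z s - Z t) <= (1 + Rabs z') * D).
  { replace (Z s - Z t) with ((Z s - Z t - z' * (s - t)) + z' * (s - t)) by ring.
    eapply Rle_trans; [apply Rabs_triang|]; rewrite Rabs_mult; fold D; nra. }
  match goal with |- Rabs ?A <= _ => replace A with
    ((f (X s) (Z s) s - f (X t) (Z t) t
      - (fr * (X s - X t) + fz * (Z s - Z t) + ft * (s - t)))
     + (fr * (X s - X t - x' * (s - t)) + fz * (Z s - Z t - z' * (s - t)))) by ring end.
  eapply Rle_trans; [apply Rabs_triang|].
  assert (B2 : Rabs (fr * (X s - X t - x' * (s - t)) + fz * (Z s - Z t - z' * (s - t)))
               <= eps / 2 * D).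
  { eapply Rle_trans; [apply Rabs_triang|]; rewrite !Rabs_mult.
    apply Rle_trans with (e2 * (Rabs fr + Rabs fz + 1) * D); [nra|].
    apply Rmult_le_compat_r; trivial. }
  assert (B1 : e1 * (Rabs (X s - X t) + Rabs (Z s - Z t) + D) <= eps / 2 * D).
  { rewrite <- E1.
    replace (e1 * (Rabs x' + Rabs z' + 3) * D) with (e1 * ((Rabs x' + Rabs z' + 3) * D)) by ring.
    apply Rmult_le_compat_l; lra. }
  fold D in Hd; lra.
Qed.

(** A path on [[a, b]] need not be differentiable at its initial time, nor are its
    values before that time controlled.  Continuing it to the left of [t] by a line
    of slope [v] makes a right derivative [v] at [t] a two-sided one, so that the
    usual chain and quotient rules apply. *)
Definition tangent_ext (t v : R) (f : R -> R) (s : R) : R :=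
  if Rle_dec t s then f s else f t + v * (s - t).

Lemma tangent_ext_right (t v : R) (f : R -> R) (s : R) : t <= s -> tangent_ext t v f s = f s.
Proof. intros H; unfold tangent_ext; destruct Rle_dec; [reflexivity | contradiction]. Qed.

Lemma continuous_on_eps (D : R -> Prop) (f : R -> R) (x : R) (eps : posreal) :
  continuous_on D f -> D x ->
  exists d : posreal, forall y, Rabs (y - x) < d -> D y -> Rabs (f y - f x) < eps.
Proof.
  intros Hf Hx; destruct (proj1 (filterlim_locally _ _) (Hf x Hx) eps) as [d Hd].
  exists d; intros y Hy HD; exact (Hd y Hy HD).
Qed.

Lemma continuous_tangent_ext (f : R -> R) (v a b t : R) :
  continuous_on (fun s => a <= s <= b) f -> a <= t < b -> continuous (tangent_ext t v f) t.
Proof.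
  intros Cf Ht; apply filterlim_locally; intros eps.
  destruct (continuous_on_eps _ f t eps Cf) as [d Hd]; [lra|].
  assert (Pv := Rabs_pos v).
  assert (Hm : 0 < Rmin (Rmin d (b - t)) (eps / (Rabs v + 1))).
  { repeat apply Rmin_glb_lt; try apply cond_pos; [lra|].
    apply Rdiv_lt_0_compat; [apply cond_pos | lra]. }
  exists (mkposreal _ Hm); intros s Hs.
  change (Rabs (s - t) < Rmin (Rmin d (b - t)) (eps / (Rabs v + 1))) in Hs.
  apply Rmin_Rgt in Hs; destruct Hs as [Hs Hse]; apply Rmin_Rgt in Hs; destruct Hs as [Hsd Hsb].
  change (Rabs (tangent_ext t v f s - tangent_ext t v f t) < eps).
  rewrite (tangent_ext_right t v f t) by lra.
  unfold tangent_ext; destruct (Rle_dec t s) as [H|H].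
  - apply Hd; [exact Hsd|]; rewrite Rabs_right in Hsb; lra.
  - replace (f t + v * (s - t) - f t) with (v * (s - t)) by ring; rewrite Rabs_mult.
    apply Rle_lt_trans with ((Rabs v + 1) * Rabs (s - t)).
    + generalize (Rabs_pos (s - t)); nra.
    + replace (pos eps) with ((Rabs v + 1) * (eps / (Rabs v + 1))) by (field; lra).
      apply Rmult_lt_compat_l; lra.
Qed.

(** The right derivative at the initial time comes from the mean value theorem and
    the continuity of the right-hand side [v] of the equation. *)
Lemma is_derive_tangent_ext (f v : R -> R) (a b t : R) :
  continuous_on (fun s => a <= s <= b) f -> continuous_on (fun s => a <= s <= b) v ->
  (forall s, a < s < b -> is_derive f s (v s)) ->
  a <= t < b -> is_derive (tangent_ext t (v t) f) t (v t).
Proof.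
  intros Cf Cv Hd Ht; apply is_derive_estimate; intros eps.
  destruct (continuous_on_eps _ v t eps Cv) as [d Hv]; [lra|].
  assert (Hm : 0 < Rmin d (b - t)) by (apply Rmin_glb_lt; [apply cond_pos | lra]).
  exists (mkposreal _ Hm); intros s Hs.
  assert (Bs : Rabs (s - t) < d /\ Rabs (s - t) < b - t).
  { change (Rabs (s - t) < Rmin d (b - t)) in Hs.
    split; eapply Rlt_le_trans; eauto; [apply Rmin_l | apply Rmin_r]. }
  rewrite (tangent_ext_right t (v t) f t) by lra.
  unfold tangent_ext; destruct (Rle_dec t s) as [H|H].
  - (* The mean value theorem needs two-sided continuity at t, which the
       extension has and f need not have. *)
    rewrite Rabs_right in Bs by lra.
    assert (Dx : forall x, t < x <= s -> is_derive (tangent_ext t (v t) f) x (v x)).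
    { intros x Hx; apply is_derive_ext_loc with f; [|apply Hd; lra].
      apply locally_interval with t b; simpl; try lra.
      intros y Hy _; simpl in Hy; symmetry; apply tangent_ext_right; lra. }
    destruct (MVT_gen (tangent_ext t (v t) f) t s v) as (c & Hc & E).
    + rewrite Rmin_left, Rmax_right by lra; intros x Hx; apply Dx; lra.
    + rewrite Rmin_left, Rmax_right by lra; intros x [[Hx|Hx] Hxs].
      * apply continuity_pt_filterlim, (ex_derive_continuous (tangent_ext t (v t) f)).
        exists (v x); apply Dx; lra.
      * subst x; apply continuity_pt_filterlim; apply (continuous_tangent_ext f (v t) a b); lra || trivial.
    + rewrite Rmin_left, Rmax_right in Hc by lra.
      rewrite !tangent_ext_right in E by lra; rewrite E.
      replace (v c * (s - t) - v t * (s - t)) with ((v c - v t) * (s - t)) by ring.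
      rewrite Rabs_mult; apply Rmult_le_compat_r; [apply Rabs_pos|].
      apply Rlt_le, Hv; [rewrite Rabs_right|]; lra.
  - replace (f t + v t * (s - t) - f t - v t * (s - t)) with 0 by ring.
    rewrite Rabs_R0; apply Rmult_le_pos; [apply Rlt_le, cond_pos | apply Rabs_pos].
Qed.

(** * Dini derivatives of absolute values *)

(** Weighing [g t] by [1 + h * m], nonnegative for small [h], keeps the sign of the
    damping coefficient [m] and covers the zeros of [g] as well. *)
Lemma upper_right_dini_abs (f g : R -> R) (t c m l : R) :
  (forall s, t <= s -> f s = g s) -> is_derive g t l -> l = c + m * g t ->
  upper_right_dini_le (fun s => Rabs (f s)) t (Rabs c + m * Rabs (g t)).
Proof.
  intros Hfg Hd Hl eta Heta.
  destruct (proj1 (is_derive_estimate _ _ _) Hd (mkposreal _ Heta)) as [d H].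
  assert (Hk : 0 < Rmin d (1 / (Rabs m + 1))).
  { apply Rmin_glb_lt; [apply cond_pos|].
    apply Rdiv_lt_0_compat; [lra | generalize (Rabs_pos m); lra]. }
  exists (mkposreal _ Hk); intros h; change R in h; intros Hh Hpos.
  change (Rabs (h - 0) < Rmin d (1 / (Rabs m + 1))) in Hh.
  rewrite Rminus_0_r, Rabs_right in Hh by lra.
  assert (Hhd : h < d) by (eapply Rlt_le_trans; [exact Hh | apply Rmin_l]).
  assert (Hhm : h * (Rabs m + 1) < 1).
  { assert (K := Rlt_le_trans _ _ _ Hh (Rmin_r _ _)).
    assert (Pm := Rabs_pos m).
    apply Rmult_lt_compat_r with (r := Rabs m + 1) in K; [|lra].
    replace (1 / (Rabs m + 1) * (Rabs m + 1)) with 1 in K by (field; lra); exact K. }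
  assert (Hmh : 0 <= 1 + h * m).
  { generalize (Rle_abs (- m)) (Rabs_pos m); rewrite Rabs_Ropp; nra. }
  assert (B : ball t d (t + h))
    by (change (Rabs (t + h - t) < d); replace (t + h - t) with h by ring;
        rewrite Rabs_right; lra).
  specialize (H _ B); simpl in H; replace (t + h - t) with h in H by ring.
  rewrite (Rabs_right h) in H by lra.
  rewrite !Hfg by lra.
  apply Rmult_le_reg_r with h; trivial.
  unfold Rdiv; rewrite Rmult_assoc, Rinv_l, Rmult_1_r by lra.
  assert (K : Rabs (g (t + h)) <= eta * h + ((1 + h * m) * Rabs (g t) + h * Rabs c)).
  { replace (g (t + h)) with
      ((g (t + h) - g t - l * h) + ((1 + h * m) * g t + h * c)) by (rewrite Hl; ring).
    eapply Rle_trans; [apply Rabs_triang|]; apply Rplus_le_compat; trivial.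
    eapply Rle_trans; [apply Rabs_triang|]; rewrite !Rabs_mult, !(Rabs_right h), (Rabs_right (1 + h * m)) by lra.
    lra. }
  lra.
Qed.

Lemma upper_right_dini_le_trans (f : R -> R) (t M M' : R) :
  upper_right_dini_le f t M -> M <= M' -> upper_right_dini_le f t M'.
Proof.
  intros H HM eta He; generalize (H eta He); apply filter_imp; intros h Hh; lra.
Qed.

(** A last-exit argument.  If [f] is above the line at [t1], let [tau] be the last
    earlier time at which it is not.  Just after [tau] the function is still on or
    below the line: by continuity if it is strictly below at [tau], and otherwise
    because its Dini derivative is smaller than the slope [eta] of the line. *)
Lemma dini_barrier (f : R -> R) (b e eta : R) :
  0 < eta -> continuous_on (fun s => 0 <= s <= b) f -> f 0 <= e ->
  (forall t, 0 <= t < b -> f t = e + eta * t -> upper_right_dini_le f t 0) ->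
  forall t, 0 <= t <= b -> f t <= e + eta * t.
Proof.
  intros He Cf H0 HD t1 Ht1.
  apply Rnot_lt_le; intros Hbad.
  destruct (completeness (fun s => 0 <= s <= t1 /\ f s <= e + eta * s)) as [tau [Hub Hlub]].
  { exists t1; intros s [Hs _]; apply Hs. }
  { exists 0; lra. }
  assert (Htau : 0 <= tau <= t1).
  { split; [apply Hub; lra | apply Hlub; intros s [Hs _]; apply Hs]. }
  destruct (Rle_lt_dec (f tau) (e + eta * tau)) as [Hle|Hgt].
  - assert (Hlt : tau < t1) by (destruct (Req_dec tau t1); [subst; lra | lra]).
    assert (Hs : exists s, tau < s <= t1 /\ f s <= e + eta * s).
    { destruct Hle as [Hlt'|Heq].
      - assert (Hp : 0 < e + eta * tau - f tau) by lra.
        destruct (continuous_on_eps _ f tau (mkposreal _ Hp) Cf) as [d Hd]; [lra|].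
        simpl in Hd.
        assert (Hm : 0 < Rmin d (t1 - tau) <= t1 - tau /\ Rmin d (t1 - tau) <= d).
        { split; [split|]; [apply Rmin_glb_lt; [apply cond_pos | lra] | apply Rmin_r | apply Rmin_l]. }
        exists (tau + Rmin d (t1 - tau) / 2); split; [lra|].
        assert (K : Rabs (f (tau + Rmin d (t1 - tau) / 2) - f tau) < e + eta * tau - f tau)
          by (apply Hd; [rewrite Rabs_right|]; lra).
        apply Rabs_def2 in K; nra.
      - destruct (HD tau ltac:(lra) Heq eta He) as [d Hd].
        assert (Hm : 0 < Rmin d (t1 - tau) <= t1 - tau /\ Rmin d (t1 - tau) <= d).
        { split; [split|]; [apply Rmin_glb_lt; [apply cond_pos | lra] | apply Rmin_r | apply Rmin_l]. }
        set (h := Rmin d (t1 - tau) / 2).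
        assert (Hh : 0 < h) by (unfold h; lra).
        exists (tau + h); split; [unfold h; lra|].
        assert (K : (f (tau + h) - f tau) / h <= 0 + eta).
        { apply Hd; trivial; change (Rabs (h - 0) < d); rewrite Rabs_right; unfold h; lra. }
        apply Rmult_le_compat_r with (r := h) in K; [|lra].
        unfold Rdiv in K; rewrite Rmult_assoc, Rinv_l, Rmult_1_r in K by lra; lra. }
    destruct Hs as (s & Hs & Hfs); assert (K : s <= tau) by (apply Hub; split; lra); lra.
  - assert (Hp : 0 < (f tau - (e + eta * tau)))  by lra.
    destruct (continuous_on_eps _ f tau (mkposreal _ Hp) Cf) as [d Hd]; [lra|].
    simpl in Hd.
    enough (K : tau <= tau - d) by (generalize (cond_pos d); lra).
    apply Hlub; intros s [Hs Hfs].
    assert (s <= tau) by (apply Hub; split; trivial).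
    apply Rnot_lt_le; intros Hsd.
    assert (K : Rabs (f s - f tau) < f tau - (e + eta * tau))
      by (apply Hd; [rewrite Rabs_left1|]; lra).
    apply Rabs_def2 in K; nra.
Qed.

(** * The slope along trajectories *)

Lemma continuous_on_path (f : field) (X Z : R -> R) (D : R -> Prop) :
  continuous_on D X -> continuous_on D Z ->
  (forall t, D t ->
     continuous (fun q : R * R * R => f (fst (fst q)) (snd (fst q)) (snd q)) (X t, Z t, t)) ->
  continuous_on D (fun s => f (X s) (Z s) s).
Proof.
  intros HX HZ Hf t Ht.
  refine (filterlim_comp _ _ _ (fun s => (X s, Z s, s)) _ _ _ _ _ (Hf t Ht)).
  apply filterlim_locally; intros eps.
  assert (BX := proj1 (filterlim_locally _ _) (HX t Ht) eps).
  assert (BZ := proj1 (filterlim_locally _ _) (HZ t Ht) eps).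
  assert (BT : within D (locally t) (fun s => ball t eps s)) by (exists eps; trivial).
  generalize (filter_and _ _ (filter_and _ _ BX BZ) BT); apply filter_imp.
  intros s [[H1 H2] H3]; repeat split; trivial.
Qed.

Lemma continuous_abs_Rslope (uth : field) (r z t : R) :
  smooth_near uth r z t -> d_z (Gam uth) r z t <> 0 ->
  continuous (fun q : R * R * R =>
    abs_field (Rslope uth) (fst (fst q)) (snd (fst q)) (snd q)) (r, z, t).
Proof.
  intros Hs H0.
  destruct (smooth_near_partials _ _ _ _ (smooth_near_Gam _ _ _ _ Hs)) as (Gr & Gz & _).
  unfold abs_field, Rslope, Rdiv.
  apply (continuous_comp _ Rabs); [|apply continuous_Rabs].
  apply (continuous_mult (K := R_AbsRing)); [exact (smooth_near_continuous _ _ _ _ Gr)|].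
  apply (continuous_comp _ Rinv); [exact (smooth_near_continuous _ _ _ _ Gz)|].
  apply continuous_Rinv; exact H0.
Qed.

(** With tangent extensions of the two coordinates, the chain rule gives [D_t] of
    each gradient component as its derivative along the trajectory, and the quotient
    rule gives the right-hand side of the Riccati equation. *)
Lemma upper_right_dini_abs_Rslope (L T : R) (ur uth uz p : field) (a b : R) (X Z : R -> R) (t : R) :
  axisymmetric_euler L T ur uth uz p -> 0 <= a -> b <= T -> trajectory ur uz a b X Z ->
  a <= t < b -> d_z (Gam uth) (X t) (Z t) t <> 0 ->
  upper_right_dini_le (fun s => Rabs (Rslope uth (X s) (Z s) s)) t
    (Rabs (- d_r uz (X t) (Z t) t + d_z ur (X t) (Z t) t * (Rslope uth (X t) (Z t) t) ^ 2)
     + (d_z uz (X t) (Z t) t - d_r ur (X t) (Z t) t) * Rabs (Rslope uth (X t) (Z t) t)).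
Proof.
  intros HE Ha Hb (HX01 & CX & CZ & HD) Ht H0.
  assert (Cyl : forall s, a <= s <= b -> in_cylinder T (X s) s)
    by (intros s Hs; split; [apply HX01 | ]; lra).
  assert (Sth : forall s, a <= s <= b ->
    smooth_near ur (X s) (Z s) s /\ smooth_near uz (X s) (Z s) s /\ smooth_near uth (X s) (Z s) s).
  { intros s Hs; repeat split; apply (smooth_near_of_cylinder T); auto; apply HE. }
  set (X' := tangent_ext t (ur (X t) (Z t) t) X).
  set (Z' := tangent_ext t (uz (X t) (Z t) t) Z).
  assert (DX : is_derive X' t (ur (X t) (Z t) t)).
  { apply (is_derive_tangent_ext X (fun s => ur (X s) (Z s) s) a b); trivial; [|apply HD].
    apply continuous_on_path; trivial.
    intros s Hs; apply smooth_near_continuous, Sth; exact Hs. }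
  assert (DZ : is_derive Z' t (uz (X t) (Z t) t)).
  { apply (is_derive_tangent_ext Z (fun s => uz (X s) (Z s) s) a b); trivial; [|apply HD].
    apply continuous_on_path; trivial.
    intros s Hs; apply smooth_near_continuous, Sth; exact Hs. }
  assert (EX : X' t = X t) by (apply tangent_ext_right; lra).
  assert (EZ : Z' t = Z t) by (apply tangent_ext_right; lra).
  destruct (Sth t ltac:(lra)) as (_ & _ & St).
  apply smooth_near_Gam in St.
  destruct (smooth_near_partials _ _ _ _ St) as (Gr & Gz & _).
  assert (Q := Rslope_riccati L T ur uth uz p _ _ _ HE (Cyl t ltac:(lra)) H0).
  unfold Rslope at 1 in Q; rewrite D_t_quotient in Q by assumption.
  rewrite <- EX, <- EZ in *.
  assert (Da := is_derive_along_path _ X' Z' t _ _ Gr DX DZ).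
  assert (Db := is_derive_along_path _ X' Z' t _ _ Gz DX DZ).
  assert (Dq := is_derive_div _ _ t _ _ Da Db H0).
  apply (upper_right_dini_abs _ _ t _ _ _) with (2 := Dq).
  - intros s Hs; unfold X', Z'; rewrite !tangent_ext_right by exact Hs; reflexivity.
  - etransitivity; [exact Q | unfold Rslope; ring].
Qed.

(** * The differential inequality and the bootstrap *)

Lemma sign_mult_le (x c m : R) : x <> 0 -> sign x * (c + m * x) <= Rabs c + m * Rabs x.
Proof.
  intros Hx; destruct (Rdichotomy _ _ Hx) as [H|H].
  - rewrite sign_eq_m1, (Rabs_left x) by exact H; generalize (Rle_abs (- c)); rewrite Rabs_Ropp; lra.
  - rewrite sign_eq_1, (Rabs_right x) by lra; generalize (Rle_abs c); lra.
Qed.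

Lemma riccati_bound (c0 C delta sigma d m q x : R) :
  m <= - (c0 * sigma) -> Rabs q <= C * sigma -> Rabs d <= delta * sigma ->
  Rabs (- d + q * x ^ 2) + m * Rabs x <=
    - c0 * sigma * Rabs x + delta * sigma + C * sigma * Rabs x ^ 2.
Proof.
  intros Hm Hq Hd.
  assert (K : Rabs (- d + q * x ^ 2) <= Rabs d + Rabs q * Rabs x ^ 2).
  { eapply Rle_trans; [apply Rabs_triang|].
    rewrite Rabs_Ropp, Rabs_mult, RPow_abs; apply Rle_refl. }
  generalize (Rabs_pos x) (pow2_ge_0 (Rabs x)); nra.
Qed.

Theorem lemma7p2 (c0 C : R) (hc0 : 0 < c0) (hC : 0 < C) :
  exists eps0 eta0 : R, 0 < eps0 /\ 0 < eta0 /\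
  forall (L T kappa delta : R) (lam : R -> R) (ur uth uz p : field)
    (Tail_shear Smooth_shear : field -> field) (err : field),
  0 < L -> 0 < T -> 0 < kappa -> 0 < delta ->
  (forall t, 0 <= t <= T -> 0 < lam t) ->
  axisymmetric_euler L T ur uth uz p ->
  (forall r z t, 0 <= t <= T -> inner_core L kappa (lam t) r z ->
     d_r ur r z t - d_z uz r z t >= c0 * sigma_wall uz t) ->
  (forall r z t, 0 <= t <= T -> inner_core L kappa (lam t) r z ->
     Rabs (d_z ur r z t) <= C * sigma_wall uz t) ->
  (exists K : R, forall r z t, 0 <= t <= T -> inner_core L kappa (lam t) r z ->
     Rabs (err r z t) <= K * lam t) ->
  (forall r z t, 0 <= t <= T -> inner_core L kappa (lam t) r z ->
     Rabs (d_r uz r z t) <=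
       C * kappa * sigma_wall uz t + Tail_shear (vort_G ur uz) r z t
       + Smooth_shear (vort_G ur uz) r z t + err r z t * sigma_wall uz t) ->
  (forall r z t, 0 <= t <= T -> inner_core L kappa (lam t) r z ->
     C * kappa * sigma_wall uz t + Tail_shear (vort_G ur uz) r z t
       + Smooth_shear (vort_G ur uz) r z t + err r z t * sigma_wall uz t
     <= delta * sigma_wall uz t) ->
  (forall r z t, 0 <= t <= T -> inner_core L kappa (lam t) r z ->
     d_z (Gam uth) r z t <> 0 -> Rslope uth r z t <> 0 ->
     D_t ur uz (abs_field (Rslope uth)) r z t <=
       - c0 * sigma_wall uz t * Rabs (Rslope uth r z t) + delta * sigma_wall uz t
       + C * sigma_wall uz t * (Rabs (Rslope uth r z t)) ^ 2) /\
  (forall (a b : R) (X Z : R -> R) (t : R),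
     0 <= a -> b <= T -> trajectory ur uz a b X Z -> a <= t < b ->
     inner_core L kappa (lam t) (X t) (Z t) ->
     d_z (Gam uth) (X t) (Z t) t <> 0 ->
     upper_right_dini_le (fun s => Rabs (Rslope uth (X s) (Z s) s)) t
       (- c0 * sigma_wall uz t * Rabs (Rslope uth (X t) (Z t) t) + delta * sigma_wall uz t
        + C * sigma_wall uz t * (Rabs (Rslope uth (X t) (Z t) t)) ^ 2)) /\
  (forall eps : R, 0 < eps <= eps0 -> delta <= eta0 * eps ->
     forall (b : R) (X Z : R -> R),
     0 <= b <= T -> trajectory ur uz 0 b X Z ->
     (forall t, 0 <= t <= b -> inner_core L kappa (lam t) (X t) (Z t) /\
        d_z (Gam uth) (X t) (Z t) t <> 0) ->
     Rabs (Rslope uth (X 0) (Z 0) 0) <= eps ->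
     forall t, 0 <= t <= b -> Rabs (Rslope uth (X t) (Z t) t) <= 2 * eps).
Proof.
  (* C * (2 * eps0) = c0 / 2 and eta0 = c0 / 2: the quadratic term and the forcing
     each absorb at most half of the damping when eps <= |R| <= 2 * eps. *)
  exists (c0 / (4 * C)), (c0 / 2).
  split; [apply Rdiv_lt_0_compat; lra | split; [lra|]].
  intros L T kappa delta lam ur uth uz p Tail_shear Smooth_shear err
    _ _ _ _ _ HE Hdiag Hoff _ Hshear Hdelta.
  assert (Bound : forall r z t, 0 <= t <= T -> inner_core L kappa (lam t) r z -> forall x,
    Rabs (- d_r uz r z t + d_z ur r z t * x ^ 2) + (d_z uz r z t - d_r ur r z t) * Rabs x <=
      - c0 * sigma_wall uz t * Rabs x + delta * sigma_wall uz t
      + C * sigma_wall uz t * Rabs x ^ 2).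
  { intros r z t Ht Hc x; apply riccati_bound.
    - specialize (Hdiag r z t Ht Hc); lra.
    - apply Hoff; assumption.
    - eapply Rle_trans; [apply Hshear | apply Hdelta]; assumption. }
  assert (Dini : forall (a b : R) (X Z : R -> R) (t : R),
     0 <= a -> b <= T -> trajectory ur uz a b X Z -> a <= t < b ->
     inner_core L kappa (lam t) (X t) (Z t) ->
     d_z (Gam uth) (X t) (Z t) t <> 0 ->
     upper_right_dini_le (fun s => Rabs (Rslope uth (X s) (Z s) s)) t
       (- c0 * sigma_wall uz t * Rabs (Rslope uth (X t) (Z t) t) + delta * sigma_wall uz t
        + C * sigma_wall uz t * (Rabs (Rslope uth (X t) (Z t) t)) ^ 2)).
  { intros a b X Z t Ha Hb Htr Ht Hc H0.
    eapply upper_right_dini_le_trans;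
      [apply (upper_right_dini_abs_Rslope L T ur uth uz p a b); assumption|].
    apply Bound; trivial; lra. }
  split; [|split; [exact Dini|]].
  - intros r z t Ht Hc H0 HR.
    assert (Hcyl : in_cylinder T r t) by (split; [apply Hc | exact Ht]).
    rewrite D_t_abs_Rslope; trivial;
      [|apply (smooth_near_of_cylinder T); trivial; apply HE].
    rewrite (Rslope_riccati L T ur uth uz p) by assumption.
    eapply Rle_trans; [|apply (Bound r z t Ht Hc)].
    eapply Rle_trans; [|apply sign_mult_le; exact HR].
    apply Req_le; ring.
  - intros eps [Heps Heps0] Hde b X Z [Hb HbT] Htr Hcore HR0 t Ht.
    (* The barrier eps + eps / (b + 1) * t stays below 2 * eps on [0, b], also if b = 0. *)
    assert (Heta : 0 < eps / (b + 1)) by (apply Rdiv_lt_0_compat; lra).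
    assert (Eeta : forall s, 0 <= s <= b -> 0 <= eps / (b + 1) * s <= eps).
    { intros s Hs; split; [apply Rmult_le_pos; lra|].
      replace eps with (eps / (b + 1) * (b + 1)) at 2 by (field; lra).
      apply Rmult_le_compat_l; lra. }
    apply Rle_trans with (eps + eps / (b + 1) * t); [|specialize (Eeta t Ht); lra].
    apply (dini_barrier (fun s => Rabs (Rslope uth (X s) (Z s) s)) b); trivial.
    + destruct Htr as (H01 & CX & CZ & _).
      apply (continuous_on_path (abs_field (Rslope uth))); trivial.
      intros s Hs; apply continuous_abs_Rslope; [|apply Hcore; exact Hs].
      apply (smooth_near_of_cylinder T); [apply HE | split; [apply H01; exact Hs | lra]].
    + intros s Hs Es; cbv beta in Es; destruct (Hcore s ltac:(lra)) as [Hc H0].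
      eapply upper_right_dini_le_trans; [apply (Dini 0 b); trivial; lra|].
      specialize (Eeta s ltac:(lra)).
      set (x := Rabs (Rslope uth (X s) (Z s) s)) in *.
      (* sigma is nonnegative because C * sigma bounds an absolute value. *)
      assert (Hsig : 0 <= sigma_wall uz s).
      { assert (K := Hoff _ _ s ltac:(lra) Hc).
        generalize (Rabs_pos (d_z ur (X s) (Z s) s)); nra. }
      assert (HCx : C * x <= c0 / 2).
      { apply Rle_trans with (C * (2 * (c0 / (4 * C)))); [|apply Req_le; field; lra].
        apply Rmult_le_compat_l; lra. }
      assert (Hxx : C * x * x <= c0 / 2 * x) by (apply Rmult_le_compat_r; lra).
      assert (Hdx : c0 / 2 * eps <= c0 / 2 * x) by (apply Rmult_le_compat_l; lra).
      assert (Hneg : - c0 * x + delta + C * x ^ 2 <= 0)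
        by (replace (C * x ^ 2) with (C * x * x) by ring; lra).
      replace (- c0 * sigma_wall uz s * x + delta * sigma_wall uz s + C * sigma_wall uz s * x ^ 2)
        with (sigma_wall uz s * (- c0 * x + delta + C * x ^ 2)) by ring.
      nra.
Qed.
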